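(* For an integer $m\ge0$ let $\mathbf{S}_m=\{1,\dots,m\}^2$, where a square $(i,j)$ has column $i$ and row $j$. Two distinct squares $(i,j),(i',j')$ attack each other (as anassas, with moves $(0,1)$ and $(1,1)$) if $i=i'$ or $i-j=i'-j'$. Let $A_{\mathbf{S}}(m,k,p)$ be the number of $k$-element subsets of $\mathbf{S}_m$ with no two elements attacking each other and with exactly $p$ elements $(i,j)$ satisfying $j<i$ (strictly below the main diagonal); set $A_{\mathbf{S}}(m,k,p)=0$ if $k<0$ or $p<0$. Then for integers $m\ge1$ and $k,p\ge 0$, $$A_{\mathbf{S}}(m,k,p)=A_{\mathbf{S}}(m-1,k,p)+(m-k+1)A_{\mathbf{S}}(m-1,k-1,p)+(m-p)A_{\mathbf{S}}(m-1,k-1,p-1)+(m-p)(m-k+1)A_{\mathbf{S}}(m-1,k-2,p-1),$$ with $A_{\mathbf{S}}(0,k,p)=\delta_{k0}\delta_{p0}$, $A_{\mathbf{S}}(m,0,p)=\delta_{p0}$, $A_{\mathbf{S}}(m,1,p)=\left\{ {m+1 \atop m}\right\}\delta_{p0}+\left\{ {m \atop m-1}\right\}\delta_{p1}$ and $A_{\mathbf{S}}(m,k,0)=\left\{ {m+1 \atop m-k+1}\right\}$. Moreover, for all integers $m,k,p\ge0$, $$A_{\mathbf{S}}(m,k,p)=\sum_{j=0}^{p}(m-k+j)_j\binom{k-p-1}{j}\binom{k-j}{k-p}\left\{ {m+1 \atop m-k+j+1}\right\}.$$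
   Context: $\delta_{ij}$ is the Kronecker delta and $(x)_j=x(x-1)\cdots(x-j+1)$, $(x)_0=1$. Stirling numbers of the second kind $\left\{ {n \atop r}\right\}$ are used in the extended sense for all integers: usual values for $n,r\ge0$; $\left\{ {n \atop r}\right\}=\left[{-r\atop -n}\right]$ (unsigned Stirling number of the first kind) for $n,r\le0$; and $0$ when one of $n,r$ is positive and the other negative. Binomial coefficients are extended to all integers $n,r$ (Kronenburg's convention): $\binom{n}{r}=n(n-1)\cdots(n-r+1)/r!$ if $r\ge0$; $\binom{n}{r}=(-1)^{n-r}\binom{-r-1}{n-r}$ if $r\le n<0$; and $\binom{n}{r}=0$ otherwise. *)

(* Defs.v *)
From HB Require Import structures.
From mathcomp Require Import all_boot all_order all_algebra.
Set Implicit Arguments. Unset Strict Implicit. Unset Printing Implicit Defensive.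
Import Order.TTheory GRing.Theory Num.Theory.
Local Open Scope ring_scope.

(* Squares of the m x m board: pairs (column, row). We index columns and rows
   by 'I_m = {0,...,m-1} instead of {1,...,m}; all conditions below
   (i = i', i - j = i' - j', j < i) are invariant under this shift. *)
Definition attack (m : nat) (a b : 'I_m * 'I_m) : bool :=
  (a != b) &&
  ((a.1 == b.1) || ((a.1 : nat)%:Z - (a.2 : nat)%:Z == (b.1 : nat)%:Z - (b.2 : nat)%:Z)).

Definition nonattacking (m : nat) (S : {set 'I_m * 'I_m}) : bool :=
  [forall a in S, forall b in S, ~~ attack a b].

Definition below (m : nat) (S : {set 'I_m * 'I_m}) : nat :=
  #|[set a in S | (a.2 < a.1)%N]|.

Definition AS_nat (m k p : nat) : nat :=
  #|[set S : {set 'I_m * 'I_m} | [&& nonattacking S, #|S| == k & below S == p]]|.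

Definition AS (m : nat) (k p : int) : int :=
  if (k < 0) || (p < 0) then 0 else (AS_nat m `|k|%N `|p|%N)%:Z.

Fixpoint stir2 (n k : nat) : nat :=
  match n, k with
  | 0, 0 => 1
  | 0, _.+1 => 0
  | _.+1, 0 => 0
  | n'.+1, k'.+1 => k'.+1 * stir2 n' k'.+1 + stir2 n' k'
  end%N.

Fixpoint stir1 (n k : nat) : nat :=
  match n, k with
  | 0, 0 => 1
  | 0, _.+1 => 0
  | _.+1, 0 => 0
  | n'.+1, k'.+1 => n' * stir1 n' k'.+1 + stir1 n' k'
  end%N.

Definition stirlingZ (n r : int) : int :=
  if (0 <= n) && (0 <= r) then (stir2 `|n|%N `|r|%N)%:Z
  else if (n <= 0) && (r <= 0) then (stir1 `|r|%N `|n|%N)%:Z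
  else 0.

Definition ffact (x : int) (j : nat) : int := \prod_(i < j) (x - (i : nat)%:Z).

(* n(n-1)...(n-r+1)/r! for r >= 0 (exact integer division) *)
Definition binom_pos (n : int) (r : nat) : int :=
  ((\prod_(i < r) (n - (i : nat)%:Z)) %/ (r`!)%:Z)%Z.

(* Kronenburg's extension of binomial coefficients to all integers *)
Definition binomZ (n r : int) : int :=
  if 0 <= r then binom_pos n `|r|%N
  else if (r <= n) && (n < 0) then (-1) ^+ `|n - r|%N * binom_pos (- r - 1) `|n - r|%N
  else 0.

Definition kdelta (a b : int) : int := if a == b then 1 else 0.

(* Main.v *)
Require Import Defs.
From HB Require Import structures.
From mathcomp Require Import all_boot all_order all_algebra zify ring.
Import Order.TTheory GRing.Theory Num.Theory.
Local Open Scope ring_scope.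

(** The recurrence removes from the board of side [m] two sets of squares: the main
    diagonal, and the part of the last column strictly below it. What remains is a
    copy of the board of side [m - 1], since moving the squares above the diagonal
    down by one merely relabels diagonals. Each removed set is a clique for the
    attack relation, so it carries at most one piece. A piece in the last column has
    to avoid the diagonals of the other below-diagonal pieces, which leaves [m - p]
    places; a piece on the main diagonal has to avoid the columns of all the other
    pieces, which leaves [m - k + 1] places.

    For the closed formula put [u = k - p] and [t = m - k] and expand by the recurrence
    of the Stirling numbers. Both sides of the recurrence become combinations of the
    numbers [stirlingZ m (t + j + 1)] with equal coefficients, by the Pascal and
    absorption identities. The exception is [u = 0], [j = p], where the Stirling number
    vanishes. *)

(** * Independent sets and the adjunction of a clique *)

Section IndependentSets.

Variables (T : finType) (e : rel T) (B : {set T}).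

Definition indep (S : {set T}) : bool := [forall a in S, forall b in S, ~~ e a b].

(** The indices are integers so that a negative [k] or [p] gives the empty set, matching the
    convention for [AS]. *)
Definition indep_sets (A : {set T}) (k p : int) : {set {set T}} :=
  [set S : {set T} | [&& S \subset A, indep S, #|S|%:Z == k & #|S :&: B|%:Z == p]].

Definition compat (S : {set T}) (q : T) : bool := [forall s in S, ~~ e q s].

Lemma indepP (S : {set T}) :
  reflect {in S &, forall a b, ~~ e a b} (indep S).
Proof.
apply: (iffP forall_inP) => [h a b aS bS|h a aS]; first exact: (forall_inP (h a aS)).
by apply/forall_inP => b bS; apply: h.
Qed.

Lemma indepS (S S' : {set T}) : S \subset S' -> indep S' -> indep S.
Proof.
move=> /subsetP sSS' /indepP h; apply/indepP => a b aS bS.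
by apply: h; apply: sSS'.
Qed.

(** A clique meets an independent set in at most one point. A counted set thus either lies in [A] or
    is uniquely [q |: S] with [S] inside [A] and [q] in [Q] compatible with [S]; each [S] admits [c]
    such [q]. *)
Lemma card_indep_sets_clique (A Q : {set T}) (b : bool) (k p c : int) :
  symmetric e -> irreflexive e -> [disjoint A & Q] ->
  {in Q &, forall x y, x != y -> e x y} ->
  {in Q, forall q, (q \in B) = b} ->
  {in indep_sets A (k - 1) (p - b%:Z),
     forall S, #|[set q in Q | compat S q]|%:Z = c} ->
  #|indep_sets (A :|: Q) k p|%:Z
  = #|indep_sets A k p|%:Z + c * #|indep_sets A (k - 1) (p - b%:Z)|%:Z.
Proof.
move=> e_sym eirr dAQ cliqQ QB cP.
set F := indep_sets A (k - 1) _ in cP *.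
pose G := [set x : {set T} * T | [&& x.1 \in F, x.2 \in Q & compat x.1 x.2]].
pose ins (x : {set T} * T) := x.2 |: x.1.
have QA q : q \in Q -> q \in A = false.
  by move=> qQ; apply/negbTE; apply: contraTN qQ => qA; rewrite (disjointFr dAQ qA).
have FA S : S \in F -> S \subset A by rewrite inE => /andP[].
have insQ x : x \in G -> ins x :&: Q = [set x.2].
  rewrite inE => /and3P[/FA sA xQ _]; apply/setP => y; rewrite !inE.
  case: eqP => [->|_] /=; first by rewrite xQ.
  apply/negbTE/negP => /andP[yS yQ].
  by have := QA _ yQ; rewrite (subsetP sA _ yS).
have insA x : x \in G -> ins x :\: Q = x.1.
  rewrite inE => /and3P[/FA sA xQ _]; apply/setP => y; rewrite !inE.
  case: eqP => [->|_] /=.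
    by rewrite xQ /=; apply/esym/negbTE/negP => /(subsetP sA); rewrite QA.
  case yS: (y \in x.1); last by rewrite andbF.
  by rewrite andbT; apply/negP => /QA; rewrite (subsetP sA _ yS).
have ins_inj : {in G &, injective ins}.
  move=> [S q] [S' q'] xG yG E; congr pair.
    by have := insA _ xG; rewrite E insA.
  by have := insQ _ xG; rewrite E insQ //= => /set1_inj.
have cardG : #|G|%:Z = c * #|F|%:Z.
  have -> : #|G| = (\sum_(S in F) #|[set q in Q | compat S q]|)%N.
    rewrite -sum1_card (eq_bigl (fun x : {set T} * T =>
      (x.1 \in F) && ((x.2 \in Q) && compat x.1 x.2))); last by move=> x; rewrite inE.
    rewrite -(pair_big_dep (mem F) (fun S q => (q \in Q) && compat S q) (fun _ _ => 1%N)) /=.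
    by apply: eq_bigr => S _; rewrite -sum1_card; apply: eq_bigl => q; rewrite inE.
  rewrite -[Posz _]natz natr_sum (eq_bigr (fun=> c)); last first.
    by move=> S SF; rewrite natz cP.
  by rewrite sumr_const -mulr_natr natz.
have -> : indep_sets (A :|: Q) k p = indep_sets A k p :|: ins @: G.
  apply/setP => S; rewrite in_setU; apply/idP/orP.
    rewrite inE => /and4P[sAQ iS kS pS].
    have [S0|[q]] := set_0Vmem (S :&: Q).
      left; rewrite inE iS kS pS /= !andbT; apply/subsetP => x xS.
      have /setUP[//|xQ] := subsetP sAQ _ xS.
      by have := in_set0 x; rewrite -S0 inE xS xQ.
    rewrite inE => /andP[qS qQ]; right.
    have SE : S = ins (S :\ q, q) by rewrite /ins /= setD1K.
    rewrite SE; apply: imset_f; rewrite !inE /= qQ /=.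
    apply/andP; split; last first.
      apply/forall_inP => s; rewrite !inE => /andP[_ sS].
      by apply: (indepP _ iS).
    apply/and4P; split.
    - apply/subsetP => x; rewrite !inE => /andP[xq xS].
      have /setUP[//|xQ] := subsetP sAQ _ xS.
      (* A second point of [S] in [Q] would be related to [q], as [Q] is a clique. *)
      by have := indepP _ iS _ _ xS qS; rewrite cliqQ.
    - by apply: indepS iS; apply: subsetDl.
    - by have := cardsD1 q S; rewrite qS; move: kS; lia.
    - rewrite setIDAC; have := cardsD1 q (S :&: B).
      by rewrite inE qS (QB _ qQ); move: pS; case: (b); lia.
  case=> [|/imsetP[[S' q] xG ->]].
    by rewrite !inE => /and4P[sA -> -> ->]; rewrite (subset_trans sA) ?subsetUl.
  move: (xG); rewrite inE /= => /and3P[]; rewrite inE => /and4P[sA iS kS pS] qQ cq.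
  have qS' : q \notin S' by apply/negP => /(subsetP sA); rewrite QA.
  rewrite inE /ins /=; apply/and4P; split.
  - by rewrite subUset sub1set inE qQ orbT (subset_trans sA) ?subsetUl.
  - apply/indepP => x y; rewrite !inE => /orP[/eqP->|xS] /orP[/eqP->|yS].
    + by rewrite eirr.
    + exact: (forall_inP cq).
    + by rewrite e_sym (forall_inP cq).
    + exact: (indepP _ iS).
  - by rewrite cardsU1 qS'; move: kS; lia.
  - rewrite setIUl; have := QB _ qQ; move: pS; case: (b) => pS qB.
      rewrite (setIidPl _) ?sub1set // cardsU1 inE (negbTE qS') /=.
      by move: pS; lia.
    rewrite (_ : [set q] :&: B = set0) ?set0U; first by move: pS; lia.
    by apply/setP => x; rewrite !inE; case: eqP => // ->.
rewrite cardsU (_ : _ :&: _ = set0) ?cards0 ?subn0; last first.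
  apply/setP => S; rewrite !inE; apply/negbTE/negP => /andP[/andP[sA _] /imsetP[x xG SE]].
  have : x.2 \in ins x :&: Q by rewrite insQ // set11.
  by rewrite -SE inE => /andP[/(subsetP sA) xA /QA]; rewrite xA.
by rewrite (card_in_imset ins_inj) PoszD cardG.
Qed.

(** Each point of [D] forbids one point of [Q], different points forbid different ones, and the rest
    of [S] forbids none. *)
Lemma card_compat (Q S D : {set T}) (f : T -> T) :
  D \subset S -> {in D, forall s, f s \in Q} -> {in D &, injective f} ->
  {in Q & S, forall q s, e q s = (s \in D) && (f s == q)} ->
  #|[set q in Q | compat S q]|%:Z = #|Q|%:Z - #|D|%:Z.
Proof.
move=> sDS fQ finj eE.
have -> : [set q in Q | compat S q] = Q :\: f @: D.
  apply/setP => q; rewrite !inE andbC; case qQ: (q \in Q); last by rewrite !andbF.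
  rewrite !andbT; apply/forall_inP/negP => [h /imsetP[s sD qE]|h s sS].
    have sS := subsetP sDS _ sD.
    by have := h s sS; rewrite eE // sD qE eqxx.
  by rewrite eE //; apply/negP => /andP[sD /eqP sq]; apply: h; rewrite -sq imset_f.
have sfQ : f @: D \subset Q by apply/subsetP => _ /imsetP[s sD ->]; apply: fQ.
by rewrite cardsDS // -subzn ?subset_leq_card // card_in_imset.
Qed.

End IndependentSets.

Lemma card_indep_sets_imset (T T' : finType) (e : rel T) (e' : rel T')
    (B : {set T}) (B' : {set T'}) (f : T -> T') (k p : int) :
  injective f -> (forall x y, e' (f x) (f y) = e x y) ->
  (forall x, (f x \in B') = (x \in B)) ->
  #|indep_sets _ e' B' (f @: setT) k p| = #|indep_sets _ e B setT k p|.
Proof.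
move=> finj eE BE; rewrite -(card_imset _ (imset_inj finj)).
apply: eq_card => S'; rewrite inE; apply/idP/imsetP; last first.
  move=> [S]; rewrite inE => /and4P[_ iS kS pS] ->; apply/and4P; split.
  - exact/imsetS/subsetT.
  - apply/indepP => _ _ /imsetP[x xS ->] /imsetP[y yS ->].
    by rewrite eE (indepP _ _ _ iS).
  - by rewrite card_imset.
  - rewrite (_ : _ :&: B' = f @: (S :&: B)) ?card_imset //.
    apply/setP => y; rewrite inE; apply/andP/imsetP.
      by move=> [/imsetP[x xS ->]]; rewrite BE => xB; exists x; rewrite ?inE ?xS.
    move=> [x]; rewrite inE => /andP[xS xB] ->; rewrite BE xB; split=> //.
    exact: imset_f.
move=> /and4P[/subsetP sS' iS kS pS].
have S'E : S' = f @: (f @^-1: S').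
  apply/setP => y; apply/idP/imsetP => [yS|[x]]; last by rewrite inE => xS ->.
  by have /imsetP[x _ yE] := sS' y yS; exists x; rewrite // inE -yE.
exists (f @^-1: S') => //; rewrite inE subsetT /=; apply/and3P; split.
- apply/indepP => x y; rewrite !inE => xS yS.
  by rewrite -eE (indepP _ _ _ iS).
- by rewrite -(card_imset _ finj) -S'E.
- rewrite -(card_imset _ finj) (_ : f @: _ = S' :&: B') //.
  apply/setP => y; rewrite inE; apply/imsetP/andP.
    by move=> [x]; rewrite !inE -BE => /andP[xS xB] ->.
  move=> [yS yB]; have /imsetP[x _ yE] := sS' y yS; exists x => //.
  by rewrite !inE -yE yS -BE -yE.
Qed.

(** * Decomposition of the board *)

Definition below_squares (m : nat) : {set 'I_m * 'I_m} :=
  [set a : 'I_m * 'I_m | (a.2 < a.1)%N].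

Lemma AS_indep_sets (m : nat) (k p : int) :
  AS m k p = #|indep_sets _ (@attack m) (below_squares m) setT k p|%:Z.
Proof.
rewrite /AS /AS_nat; case: k => k /=; last first.
  rewrite (_ : indep_sets _ _ _ _ _ _ = set0) ?cards0 //.
  apply/setP => S; rewrite !inE; apply/negbTE/negP => /and4P[_ _]; lia.
case: p => p /=; last first.
  rewrite (_ : indep_sets _ _ _ _ _ _ = set0) ?cards0 //.
  apply/setP => S; rewrite !inE; apply/negbTE/negP => /and4P[_ _]; lia.
congr Posz; apply: eq_card => S; rewrite !inE subsetT /=; congr [&& _, _ & _].
rewrite eqz_nat /below; congr (_ == _); apply: eq_card => a; by rewrite !inE.
Qed.

Lemma attackE (m : nat) (a b : 'I_m * 'I_m) :
  attack a b = (a != b) && ((a.1 == b.1 :> nat) || (a.1 + b.2 == b.1 + a.2)%N).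
Proof. rewrite /attack; congr (_ && (_ || _)); lia. Qed.

Lemma attack_sym (m : nat) : symmetric (@attack m).
Proof. move=> a b; rewrite !attackE eq_sym; congr (_ && _); lia. Qed.

Lemma attack_irr (m : nat) : irreflexive (@attack m).
Proof. by move=> a; rewrite /attack eqxx. Qed.

Lemma square_eqE (m : nat) (a b : 'I_m * 'I_m) :
  (a == b) = (a.1 == b.1 :> nat) && (a.2 == b.2 :> nat).
Proof. by case: a b => [? ?] [? ?]. Qed.

(* Bypasses the diagonal and the last column of the larger board; the squares
   missed are the diagonal and the last column strictly below it. *)
Definition board_embed {m : nat} (a : 'I_m * 'I_m) : 'I_m.+1 * 'I_m.+1 :=
  let i := widen_ord (leqnSn m) a.1 in (i, lift i a.2).

Lemma board_embed_inj (m : nat) : injective (@board_embed m).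
Proof.
move=> a b /eqP; rewrite square_eqE /= /bump => h; apply/eqP; rewrite square_eqE.
by move: h; lia.
Qed.

(** The lift raises row [j] exactly when [i <= j], so [i - j] is kept if positive and lowered by one
    otherwise. This relabels diagonals injectively and keeps columns. *)
Lemma attack_board_embed (m : nat) (a b : 'I_m * 'I_m) :
  attack (board_embed a) (board_embed b) = attack a b.
Proof.
rewrite !attackE (inj_eq (@board_embed_inj m)); congr (_ && _).
by rewrite /= /bump; lia.
Qed.

Lemma below_board_embed (m : nat) (a : 'I_m * 'I_m) :
  (board_embed a \in below_squares m.+1) = (a \in below_squares m).
Proof. by rewrite !inE /= /bump; lia. Qed.

Definition inner_squares (m : nat) : {set 'I_m.+1 * 'I_m.+1} :=
  [set a : 'I_m.+1 * 'I_m.+1 | (a.1 != m :> nat) && (a.1 != a.2 :> nat)].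

Definition column_squares (m : nat) : {set 'I_m.+1 * 'I_m.+1} :=
  [set a : 'I_m.+1 * 'I_m.+1 | (a.1 == m :> nat) && (a.2 < m)%N].

Definition diagonal_squares (m : nat) : {set 'I_m * 'I_m} :=
  [set a : 'I_m * 'I_m | a.1 == a.2 :> nat].

Lemma board_embed_setT (m : nat) : @board_embed m @: setT = inner_squares m.
Proof.
apply/setP => a; rewrite inE; apply/imsetP/idP => [[b _ ->]|].
  by have := ltn_ord b.1; rewrite /= /bump; lia.
case: a => [[i li] [j lj]] /= h.
have ii : (i < m)%N by lia.
have jj : (unbump i j < m)%N by rewrite /unbump; lia.
exists (Ordinal ii, Ordinal jj) => //; apply/eqP; rewrite square_eqE /=.
by rewrite /bump /unbump; lia.
Qed.

Lemma card_column_squares (m : nat) : #|column_squares m| = m.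
Proof.
have inj : injective (fun j : 'I_m => (ord_max : 'I_m.+1, widen_ord (leqnSn m) j)).
  by move=> i j [] /= h; apply/val_inj.
rewrite -[RHS]card_ord -(card_imset _ inj); apply: eq_card => -[i j].
rewrite inE /=; apply/idP/imsetP => [h|[j' _ [-> ->]] /=]; last by have := ltn_ord j'; lia.
have jj : (j < m)%N by lia.
by exists (Ordinal jj) => //; apply/eqP; rewrite square_eqE /=; lia.
Qed.

Lemma card_diagonal_squares (m : nat) : #|diagonal_squares m| = m.
Proof.
have inj : injective (fun j : 'I_m => (j, j)) by move=> i j [].
rewrite -[RHS]card_ord -(card_imset _ inj); apply: eq_card => -[i j].
rewrite inE /=; apply/idP/imsetP => [/eqP h|[j' _ [-> ->]] //].
by exists i => //; congr pair; apply/val_inj.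
Qed.

(** * Recurrence for the counts *)

(* A below-diagonal piece on the diagonal [d] blocks exactly one square of the
   last column, the one on the same diagonal; other pieces block none. *)
Lemma AS_add_column (m : nat) (k p : int) :
  #|indep_sets _ (@attack m.+1) (below_squares m.+1)
      (inner_squares m :|: column_squares m) k p|%:Z
  = AS m k p + (m%:Z - p + 1) * AS m (k - 1) (p - 1).
Proof.
have ASE k' p' : AS m k' p' = #|indep_sets _ (@attack m.+1) (below_squares m.+1)
    (inner_squares m) k' p'|%:Z.
  rewrite AS_indep_sets -board_embed_setT; congr Posz; apply/esym.
  apply: card_indep_sets_imset => *;
    [exact: board_embed_inj | exact: attack_board_embed | exact: below_board_embed].
rewrite !ASE; apply: (@card_indep_sets_clique _ _ _ _ _ true).
- exact: attack_sym.
- exact: attack_irr.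
- rewrite -setI_eq0; apply/eqP/setP => a; rewrite !inE; lia.
- by move=> a b; rewrite !inE attackE => ? ? -> /=; lia.
- by move=> a; rewrite !inE; lia.
move=> S; rewrite inE => /and4P[/subsetP sA iS kS pS].
(* The square of the last column, of index [m], on the diagonal of [s]; truncated subtraction is
   exact for [s] below the main diagonal. *)
pose f (s : 'I_m.+1 * 'I_m.+1) : 'I_m.+1 * 'I_m.+1 :=
  (ord_max, inord (m - (s.1 - s.2))).
have fE s : (f s).2 = (m - (s.1 - s.2))%N :> nat by rewrite /= inordK //; lia.
rewrite (@card_compat _ _ _ _ (S :&: below_squares m.+1) f).
(* [S] has [p - 1] pieces below the diagonal, so [m - (p - 1)] squares remain. *)
- by rewrite card_column_squares; move: pS; lia.
- exact: subsetIl.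
- move=> s; rewrite !inE /= -[nat_of_ord (inord _)]/(nat_of_ord (f s).2) fE.
  by case: s => [[i li] [j lj]] /= /andP[_]; lia.
- move=> s s'; rewrite !inE => /andP[sS sB] /andP[sS' sB'] /eqP.
  rewrite square_eqE !fE => h; apply/eqP.
  have := indepP _ _ _ iS _ _ sS sS'; rewrite attackE.
  have := ltn_ord s.1; have := ltn_ord s'.1.
  by case: eqP => //= _; move: h sB sB'; lia.
- move=> q s qQ sS; have := sA _ sS; move: qQ.
  rewrite !inE sS /= attackE !square_eqE fE /=.
  by case: q s {sS} => [[a la] [b lb]] [[i li] [j lj]] /=; lia.
Qed.

Lemma AS_rec (m : nat) (k p : int) :
  AS m.+1 k p = AS m k p + (m%:Z - k + 2) * AS m (k - 1) p
    + (m%:Z - p + 1) * AS m (k - 1) (p - 1)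
    + (m%:Z - p + 1) * (m%:Z - k + 2) * AS m (k - 2) (p - 1).
Proof.
have TE : setT = (inner_squares m :|: column_squares m) :|: diagonal_squares m.+1.
  by apply/setP => -[[i li] [j lj]]; rewrite !inE /=; lia.
rewrite AS_indep_sets TE.
rewrite (@card_indep_sets_clique _ _ _ _ _ false _ _ (m%:Z - k + 2)).
- by rewrite subr0 !AS_add_column (_ : k - 1 - 1 = k - 2); [ring | lia].
- exact: attack_sym.
- exact: attack_irr.
- rewrite -setI_eq0; apply/eqP/setP => a; rewrite !inE; lia.
- by move=> a b; rewrite !inE attackE => ? ? -> /=; lia.
- by move=> a; rewrite !inE; lia.
move=> S; rewrite inE => /and4P[/subsetP sA iS kS pS].
(* Every piece blocks only the diagonal square of its column, and columns are distinct:
   [(m + 1) - (k - 1)] squares remain. *)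
rewrite (@card_compat _ _ _ _ S (fun s => (s.1, s.1))).
- by rewrite card_diagonal_squares; move: kS; lia.
- exact: subxx.
- by move=> s _; rewrite inE.
- move=> s s' sS sS' [h _]; apply/eqP.
  have := indepP _ _ _ iS _ _ sS sS'; rewrite attackE.
  by case: eqP => //= _; rewrite h eqxx.
- move=> q s qQ sS; have := sA _ sS; move: qQ.
  rewrite !inE sS /= attackE !square_eqE /=.
  by case: q s {sS} => [[a la] [b lb]] [[i li] [j lj]] /=; lia.
Qed.

(** * Stirling numbers, falling factorials and binomials *)

Lemma stir2_small (n r : nat) : (n < r)%N -> stir2 n r = 0%N.
Proof.
elim: n r => [|n IH] [|r] //= h; rewrite !IH ?muln0 //; lia.
Qed.

Lemma stir2nn (n : nat) : stir2 n n = 1%N.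
Proof. by elim: n => //= n ->; rewrite stir2_small // muln0. Qed.

Lemma stirlingZ_le0 (n : nat) (r : int) : r <= 0 -> stirlingZ n.+1%:Z r = 0.
Proof.
rewrite /stirlingZ; case: r => [[|r]|r] //= _.
Qed.

Lemma stirlingZ_gt (n : nat) (r : int) : n%:Z < r -> stirlingZ n%:Z r = 0.
Proof.
rewrite /stirlingZ; case: r => [r|r] //= h; by rewrite stir2_small.
Qed.

Lemma stirlingZnn (n : nat) : stirlingZ n%:Z n%:Z = 1.
Proof. by rewrite /stirlingZ /= stir2nn. Qed.

Lemma stirlingZS (n : nat) (r : int) :
  stirlingZ (n%:Z + 1) r = r * stirlingZ n%:Z r + stirlingZ n%:Z (r - 1).
Proof.
have -> : n%:Z + 1 = n.+1%:Z by lia.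
case: r => [[|r]|r].
- rewrite stirlingZ_le0 // mul0r add0r; case: n => [|n]; last by rewrite stirlingZ_le0.
  by [].
- have -> : r.+1%:Z - 1 = r%:Z by lia.
  by rewrite /stirlingZ /=; lia.
(* For [n = 0] the values come from the first-kind branch, where [stir1 r.+1 0] is 0. *)
- rewrite stirlingZ_le0 //; case: n => [|n]; last by rewrite !stirlingZ_le0 ?mulr0 //; lia.
  have -> : Negz r - 1 = Negz r.+1 by lia.
  by rewrite /stirlingZ /= mulr0.
Qed.

Lemma ffact0 (x : int) : ffact x 0 = 1.
Proof. by rewrite /ffact big_ord0. Qed.

Lemma ffactSr (x : int) (j : nat) : ffact x j.+1 = ffact x j * (x - j%:Z).
Proof. by rewrite /ffact big_ord_recr. Qed.

Lemma ffactSl (x : int) (j : nat) : ffact x j.+1 = x * ffact (x - 1) j.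
Proof.
rewrite /ffact big_ord_recl /= subr0; congr (_ * _); apply: eq_bigr => i _.
rewrite /bump /=; lia.
Qed.

Lemma ffact_shift (x : int) (j : nat) : ffact (x + j%:Z) j.+1 = x * ffact (x + j%:Z) j.
Proof. by rewrite ffactSr mulrC; congr (_ * _); ring. Qed.

Lemma ffact_shiftl (x : int) (j : nat) :
  ffact (x + j.+1%:Z) j.+1 = (x + j.+1%:Z) * ffact (x + j%:Z) j.
Proof. by rewrite ffactSl; congr (_ * ffact _ _); lia. Qed.

Lemma ffact_nat (n j : nat) : ffact n%:Z j = (n ^_ j)%:Z.
Proof.
elim: j => [|j IH]; first by rewrite ffact0 ffactn0.
rewrite ffactSr IH ffactnSr; case: (leqP j n) => h; first by rewrite subzn // PoszM.
by rewrite ffact_small // mul0n mul0r.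
Qed.

Lemma ffactN1 (j : nat) : ffact (-1) j = (-1) ^+ j * (j`!)%:Z.
Proof.
elim: j => [|j IH]; first by rewrite ffact0.
by rewrite ffactSr IH factS exprS PoszM; lia.
Qed.

Lemma binom_pos_nat (n j : nat) : binom_pos n%:Z j = ('C(n, j))%:Z.
Proof.
rewrite /binom_pos -/(ffact n%:Z j) ffact_nat -bin_ffact PoszM mulzK //.
by have := fact_gt0 j; lia.
Qed.

Lemma binom_posN1 (j : nat) : binom_pos (-1) j = (-1) ^+ j.
Proof.
rewrite /binom_pos -/(ffact (-1) j) ffactN1 mulzK //.
by have := fact_gt0 j; lia.
Qed.

(* [binpred u j] is the generalized binomial coefficient of [u - 1] over [j],
   which is [(-1) ^+ j] at [u = 0]. *)
Definition binpred (u j : nat) : int :=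
  if u is u'.+1 then ('C(u', j))%:Z else (-1) ^+ j.

Lemma binpred0 (u : nat) : binpred u 0 = 1.
Proof. by case: u => [|u] //=; rewrite bin0. Qed.

Lemma binpredS (u j : nat) : binpred u.+1 j.+1 = binpred u j.+1 + binpred u j.
Proof.
case: u => [|u] /=; first by rewrite exprS bin0n; lia.
by rewrite binS; lia.
Qed.

Lemma mul_binpred_diag (u j : nat) :
  j.+1%:Z * binpred u.+1 j.+1 = u%:Z * binpred u j.
Proof.
case: u => [|u] /=; first by rewrite bin0n mulr0 mul0r.
by rewrite -!PoszM mul_bin_diag.
Qed.

Lemma mul_binpred_left (u j : nat) :
  j.+1%:Z * binpred u j.+1 = (u%:Z - j%:Z - 1) * binpred u j.
Proof.
case: u => [|u] /=; first by rewrite exprS; lia.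
rewrite -PoszM mul_bin_left; case: (leqP j u) => h.
  by have -> : u.+1%:Z - j%:Z - 1 = (u - j)%N%:Z by lia.
by rewrite bin_small // muln0 mulr0.
Qed.

Lemma binomZ_pred (u j : nat) : binomZ (u%:Z - 1) j%:Z = binpred u j.
Proof.
rewrite /binomZ /=; case: u => [|u] /=; first by rewrite sub0r binom_posN1.
by have -> : u.+1%:Z - 1 = u%:Z; [lia | rewrite binom_pos_nat].
Qed.

(* Coefficient vanishing for [p < j], so that sums over [j] may be extended. *)
Definition bincut (u p j : nat) : int := if (j <= p)%N then ('C(u + p - j, u))%:Z else 0.

(** Pascal's rule, which survives the cut: at [j = p] it reads 1 = 0 + 1. *)
Lemma bincutSl (u p j : nat) :
  bincut u.+1 p j = bincut u.+1 p j.+1 + bincut u p j.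
Proof.
rewrite /bincut; case: (ltngtP j p) => h; last by rewrite h !addnK !binn.
- have -> : (u.+1 + p - j = (u.+1 + p - j.+1).+1)%N by lia.
  have -> : (u + p - j = u.+1 + p - j.+1)%N by lia.
  by rewrite binS; lia.
- by [].
Qed.

Lemma bincutSS (u p j : nat) : bincut u p.+1 j.+1 = bincut u p j.
Proof. by rewrite /bincut ltnS addnS subSS. Qed.

Lemma binomZ_cut (u p j : nat) : (j <= p)%N ->
  binomZ ((u + p)%N%:Z - j%:Z) u%:Z = bincut u p j.
Proof.
move=> jp; rewrite /binomZ /bincut jp /= -binom_pos_nat; congr binom_pos; lia.
Qed.

(** * Closed formula and initial values *)

(* The summand of the closed formula, with [k = u + p]. *)
Definition anassa_term (m u p j : nat) : int :=
  let t := m%:Z - (u + p)%N%:Z in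
  ffact (t + j%:Z) j * binpred u j * bincut u p j * stirlingZ (m%:Z + 1) (t + j%:Z + 1).

Definition anassa_sum (m u p : nat) : int := \sum_(0 <= j < p.+1) anassa_term m u p j.

Lemma anassa_sum_widen (m u p N : nat) : (p < N)%N ->
  anassa_sum m u p = \sum_(0 <= j < N) anassa_term m u p j.
Proof.
move=> pN; rewrite /anassa_sum [RHS](big_cat_nat _ (n := p.+1)) //=.
rewrite [X in _ + X]big1_seq ?addr0 // => j; rewrite mem_index_iota => /andP[_ /andP[pj _]].
by rewrite /anassa_term /bincut leqNgt pj /= mulr0 mul0r.
Qed.

Lemma AS_lt (m k p : nat) : (k < p)%N -> AS m k p = 0.
Proof.
move=> kp; rewrite AS_indep_sets; congr Posz; apply/eqP.
rewrite cards_eq0; apply/eqP/setP => S; rewrite !inE.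
apply/negbTE/negP => /and4P[_ _ kS pS].
by have := subset_leq_card (subsetIl S (below_squares m)); move: kS pS; lia.
Qed.

Lemma AS_neg (m : nat) (k p : int) : (k < 0) || (p < 0) -> AS m k p = 0.
Proof. by rewrite /AS => ->. Qed.

Lemma AS0 (k p : nat) : AS 0 k p = kdelta k 0 * kdelta p 0.
Proof.
rewrite AS_indep_sets.
have -> : indep_sets _ (@attack 0) (below_squares 0) setT k p
    = if (k == 0%N) && (p == 0%N) then [set set0] else set0.
  apply/setP => S; have -> : S = set0 by apply/setP => -[[]].
  rewrite !inE set0I cards0 sub0set /=.
  have -> : indep _ (@attack 0) set0 by apply/indepP => a b; rewrite inE.
  by case: k p => [|k] [|p] /=; rewrite !inE ?eqxx.
by case: k p => [|k] [|p] /=; rewrite ?cards0 ?cards1.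
Qed.

(** Row 1 of the Stirling numbers is supported in column 1, that is at [j = u + p]. If this [j] is
    positive, the falling factorial starts with the factor 0. *)
Lemma anassa_sum0 (u p : nat) : anassa_sum 0 u p = kdelta u 0 * kdelta p 0.
Proof.
rewrite /anassa_sum big_nat_recl // big1 ?addr0.
  rewrite /anassa_term ffact0 mul1r binpred0 mul1r /bincut /= subn0.
  case: u p => [|u] [|p] //=; rewrite ?[stirlingZ _ _]stirlingZ_le0 ?mulr0 //; lia.
move=> j _; rewrite /anassa_term.
have [tj|tj] := eqVneq ((u + p)%N) j.+1.
  by rewrite (_ : _ + j.+1%:Z = 0); [rewrite ffactSl !mul0r | lia].
rewrite [stirlingZ _ _](_ : _ = 0) ?mulr0 //.
have [h|h] := ltnP j.+1 (u + p); first by apply: stirlingZ_le0; lia.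
by apply: (stirlingZ_gt 1); lia.
Qed.


(** * Recurrence for the closed formula *)

(* In the recurrence for the closed formula, the coefficients of [stirlingZ m (t + j + 1)],
   where [t = m - k], agree after division by [ffact (t + j) j]. *)
Lemma anassa_coef_rec (t : int) (u p j : nat) :
  (t + j%:Z + 1) * (binpred u.+1 j * bincut u.+1 p j
                    + binpred u.+1 j.+1 * bincut u.+1 p j.+1)
  = t * binpred u.+1 j.+1 * bincut u.+1 p j.+1
    + (t + 1) * binpred u j * bincut u p j
    + (t + u.+1%:Z) * binpred u.+1 j * bincut u.+1 p j.+1
    + (t + u.+1%:Z) * (if j is j'.+1 then binpred u j' else 0) * bincut u p j.
Proof.
rewrite bincutSl; move: (bincut u.+1 p j.+1) (bincut u p j) => X Y.
have h1 := mul_binpred_left u.+1 j.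
apply/eqP; rewrite -subr_eq0; apply/eqP.
set b := (if j is _.+1 then _ else _).
have h2 : j%:Z * binpred u.+1 j = u%:Z * b.
  by case: j @b {h1} => [|j] b; rewrite ?mul_binpred_diag // mul0r mulr0.
have h3 : binpred u.+1 j = binpred u j + b.
  by case: j @b {h1 h2} => [|j] b; rewrite ?binpredS // !binpred0 addr0.
(* The difference of both sides is a combination of the absorption identities [h1], [h2] and
   Pascal's rule [h3]. *)
rewrite [LHS](_ : _ = X * (j.+1%:Z * binpred u.+1 j.+1 - (u.+1%:Z - j%:Z - 1) * binpred u.+1 j)
  + Y * (j%:Z * binpred u.+1 j - u%:Z * b) + (t + 1) * Y * (binpred u.+1 j - (binpred u j + b))).
  by rewrite h1 h2 {3}h3 !subrr !mulr0 !addr0.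
by rewrite !intS; ring.
Qed.

(** With [bincut 0 p] an indicator and [binpred 0] alternating, each side cancels for [j < p]; only
    [j = p] leaves a remainder. *)
Lemma anassa_coef_rec0 (t : int) (p j : nat) :
  (t + j%:Z + 1) * (binpred 0 j * bincut 0 p j + binpred 0 j.+1 * bincut 0 p j.+1)
  = t * binpred 0 j.+1 * bincut 0 p j.+1 + t * binpred 0 j * bincut 0 p j.+1
    + (if j == p then (t + j%:Z + 1) * binpred 0 j else 0).
Proof.
rewrite /bincut /= !bin0 exprS; case: (ltngtP j p) => _; ring.
Qed.

Section SumShift.

Variables m u p : nat.
Let t : int := m.+1%:Z - (u + p)%N%:Z.
Let E (j : nat) : int := ffact (t + j%:Z) j.
Let W (j : nat) : int := stirlingZ (m%:Z + 1) (t + j%:Z + 1).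

(** [stirlingZS] splits each summand into multiples of columns [t + j + 1] and [t + j]. Shifting [j]
    in the second part brings it to [W j], splits [t + j + 1] off the falling factorial, and leaves
    the term [j = 0] apart. *)
Lemma anassa_sum_split :
  anassa_sum m.+1 u p
  = bincut u p 0 * stirlingZ (m%:Z + 1) t
    + \sum_(0 <= j < p.+1) E j * ((t + j%:Z + 1)
         * (binpred u j * bincut u p j + binpred u j.+1 * bincut u p j.+1)) * W j.
Proof.
pose b j := E j * binpred u j * bincut u p j * stirlingZ (m%:Z + 1) (t + j%:Z).
have -> : anassa_sum m.+1 u p = \sum_(0 <= j < p.+1)
    (E j * binpred u j * bincut u p j * ((t + j%:Z + 1) * W j) + b j).
  apply: eq_bigr => j _; rewrite /anassa_term -/t -/(E j).
  rewrite (_ : m.+1%:Z = m%:Z + 1); last lia.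
  have -> : m%:Z + 1 + 1 = m.+1%:Z + 1 by lia.
  rewrite stirlingZS (_ : m.+1%:Z = m%:Z + 1); last lia.
  by rewrite addrK mulrDr.
rewrite big_split /=.
(* The extra term vanishes by the cut; it makes room for the shift. *)
have -> : \sum_(0 <= j < p.+1) b j = \sum_(0 <= j < p.+2) b j.
  by rewrite [RHS]big_nat_recr //= {3}/b /bincut ltnn mulr0 mul0r addr0.
rewrite [X in _ + X]big_nat_recl // addrCA -big_split /=; congr (_ + _).
  by rewrite /b /E ffact0 binpred0 !mul1r addr0.
apply: eq_bigr => j _; rewrite /b {2}/E ffact_shiftl -/(E j).
have -> : t + j.+1%:Z = t + j%:Z + 1 by lia.
rewrite -/(W j); ring.
Qed.

(** Here [t] drops by one, so summand [j + 1] carries [W j], and the last factor of its falling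
    factorial is [t]. *)
Lemma anassa_sum_split_same :
  anassa_sum m u p
  = bincut u p 0 * stirlingZ (m%:Z + 1) t
    + \sum_(0 <= j < p.+1) E j * (t * binpred u j.+1 * bincut u p j.+1) * W j.
Proof.
rewrite (@anassa_sum_widen _ _ _ p.+2) // big_nat_recl //; congr (_ + _).
  rewrite /anassa_term ffact0 binpred0 !mul1r; congr (_ * stirlingZ _ _); lia.
apply: eq_bigr => j _; rewrite /anassa_term.
have -> : m%:Z - (u + p)%N%:Z + j.+1%:Z = t + j%:Z by lia.
rewrite ffact_shift -/(E j) -/(W j); ring.
Qed.

Lemma anassa_sum_pred_p :
  (if p is p'.+1 then anassa_sum m u p' else 0)
  = \sum_(0 <= j < p.+1) E j * (binpred u j * bincut u p j.+1) * W j.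
Proof.
rewrite /E /W /t; case: p => [|q].
  by rewrite big_nat1 /bincut /= mulr0 mulr0 mul0r.
rewrite (@anassa_sum_widen _ _ _ q.+2) //; apply: eq_bigr => j _.
rewrite /anassa_term bincutSS (_ : m.+1%:Z - (u + q.+1)%N%:Z = m%:Z - (u + q)%N%:Z); last lia.
ring.
Qed.

End SumShift.

Lemma anassa_sum_pred_u (m u p : nat) (t := m.+1%:Z - (u.+1 + p)%N%:Z) :
  anassa_sum m u p
  = \sum_(0 <= j < p.+1) ffact (t + j%:Z) j * (binpred u j * bincut u p j)
      * stirlingZ (m%:Z + 1) (t + j%:Z + 1).
Proof.
apply: eq_bigr => j _; rewrite /anassa_term (_ : m%:Z - (u + p)%N%:Z = t); last lia.
ring.
Qed.

(** Here [t] grows by one: summand [j] moves to index [j + 1], and the factor [t + 1] completes its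
    falling factorial. *)
Lemma anassa_sum_pred_up (m u p : nat) (t := m.+1%:Z - (u.+1 + p)%N%:Z) :
  (t + 1) * (if p is p'.+1 then anassa_sum m u p' else 0)
  = \sum_(0 <= j < p.+1) ffact (t + j%:Z) j
      * ((if j is j'.+1 then binpred u j' else 0) * bincut u p j)
      * stirlingZ (m%:Z + 1) (t + j%:Z + 1).
Proof.
rewrite [RHS]big_nat_recl // mul0r mulr0 mul0r add0r.
rewrite {}/t; case: p => [|q]; first by rewrite big_nil mulr0.
rewrite /anassa_sum big_distrr /=; apply: eq_bigr => j _.
rewrite /anassa_term bincutSS (_ : m.+1%:Z - (u.+1 + q.+1)%N%:Z = m%:Z - (u + q)%N%:Z - 1); last lia.
move: (m%:Z - _) => t; rewrite subrK.
have -> : t - 1 + j.+1%:Z = t + j%:Z by lia.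
rewrite ffact_shift; ring.
Qed.

(** This mirrors [AS_rec] for [k = u + p]: lowering [k] alone lowers [u], while lowering [k] and [p]
    together keeps it. *)
Lemma anassa_sum_rec (m u p : nat) :
  anassa_sum m.+1 u p
  = anassa_sum m u p
    + (m%:Z - (u + p)%N%:Z + 2) * (if u is u'.+1 then anassa_sum m u' p else 0)
    + (m%:Z - p%:Z + 1) * (if p is p'.+1 then anassa_sum m u p' else 0)
    + (m%:Z - p%:Z + 1) * ((m%:Z - (u + p)%N%:Z + 2)
        * (if u is u'.+1 then if p is p'.+1 then anassa_sum m u' p' else 0 else 0)).
Proof.
rewrite anassa_sum_split anassa_sum_split_same -!(addrA (bincut u p 0 * _)); congr (_ + _).
rewrite anassa_sum_pred_p; case: u => [|u].
  rewrite !mulr0 !addr0 big_distrr -big_split /=.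
  apply: eq_big_nat => j jp; rewrite anassa_coef_rec0.
  case: eqP => [jE|_].
    (* For [u = 0] and [j = p] the column is [m + 2], beyond row [m + 1]. *)
    rewrite [stirlingZ _ _](_ : _ = 0) ?mulr0 ?addr0 //.
    by rewrite (_ : m%:Z + 1 = m.+1%:Z); [apply: stirlingZ_gt|]; lia.
  by rewrite (_ : m.+1%:Z - (0 + p)%N%:Z = m%:Z - p%:Z + 1); [ring | lia].
have -> : m%:Z - (u.+1 + p)%N%:Z + 2 = m.+1%:Z - (u.+1 + p)%N%:Z + 1 by lia.
rewrite anassa_sum_pred_up anassa_sum_pred_u !big_distrr -!big_split /=.
apply: eq_bigr => j _; rewrite anassa_coef_rec.
have -> : m%:Z - p%:Z + 1 = m.+1%:Z - (u.+1 + p)%N%:Z + u.+1%:Z by lia.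
ring.
Qed.

(** * Equality of the counts and the closed formula *)

Lemma AS_anassa_sum (m u p : nat) : AS m (u + p)%N p = anassa_sum m u p.
Proof.
elim: m u p => [|m IH] u p.
  by rewrite anassa_sum0 AS0; case: u p => [|u] [|p].
rewrite AS_rec anassa_sum_rec IH; congr (_ + _ + _ + _).
(* For [u = 0] this count has [k - 1 < p] and vanishes. *)
- congr (_ * _); case: u => [|u]; last first.
    by rewrite -IH; congr AS; lia.
  case: p => [|p]; first by rewrite AS_neg.
  by rewrite (_ : (0 + p.+1)%N%:Z - 1 = p); [apply: AS_lt | lia].
- congr (_ * _); case: p => [|p]; first by rewrite AS_neg // orbT.
  by rewrite -IH; congr AS; lia.
- rewrite -mulrA; congr (_ * (_ * _)); case: p => [|p]; first by rewrite AS_neg ?orbT //; case: u.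
  case: u => [|u]; last by rewrite -IH; congr AS; lia.
  case: p => [|p]; first by rewrite AS_neg.
  have -> : (0 + p.+2)%N%:Z - 2 = p by lia.
  have -> : p.+2%:Z - 1 = p.+1 by lia.
  exact: AS_lt.
Qed.

Lemma AS_closed (m k p : nat) :
  AS m k p =
    \sum_(0 <= j < p.+1)
       ffact (m%:Z - k%:Z + j%:Z) j
       * binomZ (k%:Z - p%:Z - 1) j%:Z
       * binomZ (k%:Z - j%:Z) (k%:Z - p%:Z)
       * stirlingZ (m%:Z + 1) (m%:Z - k%:Z + j%:Z + 1).
Proof.
case: (leqP p k) => [pk|kp].
  rewrite -(subnK pk); move: (k - p)%N => u; rewrite AS_anassa_sum.
  apply: eq_big_nat => j /andP[_ jp]; rewrite /anassa_term.
  have -> : (u + p)%N%:Z - p%:Z = u%:Z by lia.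
  by rewrite binomZ_pred binomZ_cut.
(* For [k < p] every summand vanishes: if [j > k] the Stirling column exceeds its row, and if
   [j <= k] the second binomial has a nonnegative top and a negative bottom. *)
rewrite AS_lt // big1 // => j _.
case: (leqP j k) => jk; last first.
  rewrite [stirlingZ _ _](_ : _ = 0) ?mulr0 //.
  by rewrite (_ : m%:Z + 1 = m.+1%:Z); [apply: stirlingZ_gt|]; lia.
rewrite [binomZ (k%:Z - j%:Z) _](_ : _ = 0) ?mulr0 ?mul0r //.
by rewrite /binomZ !ifF //; lia.
Qed.

Theorem theorem3p1 :
  (forall m k p : nat, (1 <= m)%N ->
     [/\ AS m k p =
           AS m.-1 k p
           + (m%:Z - k%:Z + 1) * AS m.-1 (k%:Z - 1) p
           + (m%:Z - p%:Z) * AS m.-1 (k%:Z - 1) (p%:Z - 1)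
           + (m%:Z - p%:Z) * (m%:Z - k%:Z + 1) * AS m.-1 (k%:Z - 2) (p%:Z - 1),
         AS m 0 p = kdelta p 0,
         AS m 1 p = stirlingZ (m%:Z + 1) m%:Z * kdelta p 0
                    + stirlingZ m%:Z (m%:Z - 1) * kdelta p 1
       & AS m k 0 = stirlingZ (m%:Z + 1) (m%:Z - k%:Z + 1)]) /\
  (forall k p : nat, AS 0 k p = kdelta k 0 * kdelta p 0) /\
  (forall m k p : nat,
     AS m k p =
       \sum_(0 <= j < p.+1)
          ffact (m%:Z - k%:Z + j%:Z) j
          * binomZ (k%:Z - p%:Z - 1) j%:Z
          * binomZ (k%:Z - j%:Z) (k%:Z - p%:Z)
          * stirlingZ (m%:Z + 1) (m%:Z - k%:Z + j%:Z + 1)).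
Proof.
split; last by split; [exact: AS0 | exact: AS_closed].
have ASk0 m (k : nat) : AS m k 0 = stirlingZ (m%:Z + 1) (m%:Z - k%:Z + 1).
  have := AS_anassa_sum m k 0; rewrite addn0 => ->.
  rewrite /anassa_sum big_nat1 /anassa_term ffact0 binpred0 /bincut addn0 subn0 binn /=.
  by rewrite !mul1r addr0.
move=> [|m] k p // _; split; last exact: ASk0.
- rewrite AS_rec /=; have -> : m.+1%:Z - k%:Z + 1 = m%:Z - k%:Z + 2 by lia.
  by have -> : m.+1%:Z - p%:Z = m%:Z - p%:Z + 1 by lia.
- case: p => [|p]; last exact: (AS_lt _ 0).
  by rewrite (ASk0 _ 0%N) subr0 (_ : _ + 1 = m.+2%:Z) ?stirlingZnn //; lia.
- case: p => [|[|p]]; last by rewrite (AS_lt _ 1) // /kdelta /= !mulr0.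
    by rewrite (ASk0 _ 1%N) subrK /kdelta /= mulr1 mulr0 addr0.
  (* The two summands give [S(m+2, m+1) - (m+1) S(m+2, m+2)], with [S] the Stirling numbers; this is
     [S(m+1, m)] by their recurrence. *)
  rewrite (AS_anassa_sum _ 0 1) /anassa_sum big_nat_recl // big_nat1 /anassa_term.
  rewrite ffact0 ffactSr ffact0 /bincut /= /kdelta /= mulr0 mulr1 add0r.
  have -> : m.+1%:Z - 1 + 0 + 1 = m.+1%:Z by lia.
  have -> : m.+1%:Z - 1 + 1 + 1 = m.+2%:Z by lia.
  rewrite !bin0 stirlingZS stirlingZnn (_ : m.+1%:Z + 1 = m.+2%:Z) ?stirlingZnn; last lia.
  by ring.
Qed.
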